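(* Let $f:\mathbb{R}^n\times\mathbb{R}^m\to\mathbb{R}$ be twice continuously differentiable with $\nabla f$ Lipschitz with constant $L$, and let $0<\alpha<\frac1L$. (1) The set of initial vectors $(\mathbf{x}_0,\mathbf{y}_0)\in\mathbb{R}^{n+m}$ for which the GDA iterates with stepsize $\alpha$ converge to some (linearly) GDA-unstable fixed point (critical point of $f$) has Lebesgue measure zero. (2) If in addition the Hessian $\nabla^2 f(\mathbf{x},\mathbf{y})$ is invertible for all $(\mathbf{x},\mathbf{y})$, then the set of initial vectors $(\mathbf{x}_1,\mathbf{y}_1,\mathbf{x}_0,\mathbf{y}_0)\in\mathbb{R}^{2n+2m}$ for which the OGDA iterates with stepsize $\alpha$ converge to some (linearly) OGDA-unstable fixed point has Lebesgue measure zero.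
   Context: GDA with stepsize $\alpha>0$ is the dynamical system on $\mathbb{R}^{n+m}$ with update rule $h(\mathbf{x},\mathbf{y})=(\mathbf{x}-\alpha\nabla_{\mathbf{x}}f(\mathbf{x},\mathbf{y}),\ \mathbf{y}+\alpha\nabla_{\mathbf{y}}f(\mathbf{x},\mathbf{y}))$. Its fixed points are exactly the critical points of $f$ (points where $\nabla f=\mathbf{0}$). OGDA with stepsize $\alpha>0$ is the recursion $\mathbf{x}_{t+1}=\mathbf{x}_t-2\alpha\nabla_{\mathbf{x}}f(\mathbf{x}_t,\mathbf{y}_t)+\alpha\nabla_{\mathbf{x}}f(\mathbf{x}_{t-1},\mathbf{y}_{t-1})$, $\mathbf{y}_{t+1}=\mathbf{y}_t+2\alpha\nabla_{\mathbf{y}}f(\mathbf{x}_t,\mathbf{y}_t)-\alpha\nabla_{\mathbf{y}}f(\mathbf{x}_{t-1},\mathbf{y}_{t-1})$. It is viewed as the dynamical system $(\mathbf{x}_{t+1},\mathbf{y}_{t+1},\mathbf{x}_t,\mathbf{y}_t)=g(\mathbf{x}_t,\mathbf{y}_t,\mathbf{x}_{t-1},\mathbf{y}_{t-1})$ on $\mathbb{R}^{2n+2m}$ with update rule $g(\mathbf{x},\mathbf{y},\mathbf{z},\mathbf{w})=(\mathbf{x}-2\alpha\nabla_{\mathbf{x}}f(\mathbf{x},\mathbf{y})+\alpha\nabla_{\mathbf{x}}f(\mathbf{z},\mathbf{w}),\ \mathbf{y}+2\alpha\nabla_{\mathbf{y}}f(\mathbf{x},\mathbf{y})-\alpha\nabla_{\mathbf{y}}f(\mathbf{z},\mathbf{w}),\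 \mathbf{x},\ \mathbf{y})$, where $\nabla_{\mathbf{x}}f(\mathbf{z},\mathbf{w})$, $\nabla_{\mathbf{y}}f(\mathbf{z},\mathbf{w})$ denote the partial gradients of $f$ in its first and second block of variables evaluated at $(\mathbf{z},\mathbf{w})$. Its fixed points are the points $(\mathbf{x},\mathbf{y},\mathbf{x},\mathbf{y})$ with $\nabla f(\mathbf{x},\mathbf{y})=\mathbf{0}$. A fixed point of an update rule is (linearly) unstable if the Jacobian of the update rule at that point has spectral radius strictly greater than $1$. GDA-unstable and OGDA-unstable mean unstable as a fixed point of $h$, respectively $g$, for the given stepsize $\alpha$. *)

(* Defs.v *)
From HB Require Import structures.
From mathcomp Require Import all_boot all_order all_algebra.
From mathcomp Require Import complex.
From mathcomp Require Import all_classical all_reals all_analysis.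

Set Implicit Arguments.
Unset Strict Implicit.
Unset Printing Implicit Defensive.

Import Order.TTheory GRing.Theory Num.Theory.
Import numFieldNormedType.Exports.

Local Open Scope classical_set_scope.
Local Open Scope ring_scope.

(* The library norm on ['rV[R]_N] is the sup norm; the Lipschitz constant of
   the gradient refers to the Euclidean one. *)
Definition eucl_norm (R : realType) (N : nat) (v : 'rV[R]_N) : R :=
  Num.sqrt (\sum_(i < N) v 0 i ^+ 2).

Definition box (R : realType) (N : nat) (a b : 'rV[R]_N) : set 'rV[R]_N :=
  [set x | forall i, a 0 i <= x 0 i <= b 0 i].

(* A cover is a family of closed boxes indexed by the [k : nat] with [P k], so
   that finite and empty families are allowed: in dimension 0 every box is a
   point of volume 1, and the empty set needs the empty cover. *)
Definition lebesgue_outer_measure (R : realType) (N : nat)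
    (X : set 'rV[R]_N) : \bar R :=
  ereal_inf [set s | exists (P : pred nat) (a b : nat -> 'rV[R]_N),
    [/\ forall k i, P k -> a k 0 i <= b k 0 i,
        X `<=` \bigcup_(k in [set k | P k]) box (a k) (b k)
      & s = (\sum_(k <oo | P k) (\prod_(i < N) (b k 0 i - a k 0 i))%:E)%E]].

Definition lebesgue_null (R : realType) (N : nat) (X : set 'rV[R]_N) : Prop :=
  lebesgue_outer_measure X = 0%E.

Definition spectral_radius (R : realType) (N : nat) (A : 'M[R]_N) : R :=
  sup [set Normc.normc z | z in
    [set z : R[i] | eigenvalue (map_mx (real_complex R) A) z]].

Definition linearly_unstable (R : realType) (N : nat)
    (h : 'rV[R]_N -> 'rV[R]_N) (p : 'rV[R]_N) : Prop :=
  h p = p /\ 1 < spectral_radius (jacobian h p).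

Definition converges_to_unstable (R : realType) (N : nat)
    (h : 'rV[R]_N -> 'rV[R]_N) : set 'rV[R]_N :=
  [set p0 | exists p, linearly_unstable h p /\
                      (fun t : nat => iter t h p0) @ \oo --> p].

Definition grad (R : realType) (N : nat) (f : 'rV[R]_N -> R) (p : 'rV[R]_N) :
    'rV[R]_N :=
  \row_(i < N) 'D_(delta_mx 0 i) f p.

Definition hessian (R : realType) (N : nat) (f : 'rV[R]_N -> R)
    (p : 'rV[R]_N) : 'M[R]_N :=
  jacobian (grad f) p.

Definition twice_continuously_differentiable (R : realType) (N : nat)
    (f : 'rV[R]_N -> R) : Prop :=
  [/\ forall p, differentiable f p,
      forall p, differentiable (grad f) p
    & continuous (hessian f)].

(* R^n x R^m is identified with ['rV[R]_(n + m)] through [row_mx], so that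
   [lsubmx p] is x and [rsubmx p] is y when p = (x, y). *)
Definition grad_x (R : realType) (n m : nat) (f : 'rV[R]_(n + m) -> R)
    (p : 'rV[R]_(n + m)) : 'rV[R]_n :=
  lsubmx (grad f p).

Definition grad_y (R : realType) (n m : nat) (f : 'rV[R]_(n + m) -> R)
    (p : 'rV[R]_(n + m)) : 'rV[R]_m :=
  rsubmx (grad f p).

Definition GDA (R : realType) (n m : nat) (f : 'rV[R]_(n + m) -> R)
    (alpha : R) (p : 'rV[R]_(n + m)) : 'rV[R]_(n + m) :=
  row_mx (lsubmx p - alpha *: grad_x f p) (rsubmx p + alpha *: grad_y f p).

(* The state is (p, q) with p = (x, y) the current iterate and q = (z, w) the
   previous one. *)
Definition OGDA (R : realType) (n m : nat) (f : 'rV[R]_(n + m) -> R)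
    (alpha : R) (s : 'rV[R]_((n + m) + (n + m))) :
    'rV[R]_((n + m) + (n + m)) :=
  let p := lsubmx s in
  let q := rsubmx s in
  row_mx
    (row_mx
      (lsubmx p - (2 * alpha) *: grad_x f p + alpha *: grad_x f q)
      (rsubmx p + (2 * alpha) *: grad_y f p - alpha *: grad_y f q))
    p.

(* Main.v *)
Require Import Defs.
From mathcomp Require Import all_boot all_order all_algebra.
From mathcomp Require Import complex.
From mathcomp Require Import all_classical all_reals all_analysis.
From mathcomp Require Import spectral ring lra.

Import Order.TTheory GRing.Theory Num.Theory.
Import numFieldNormedType.Exports.

Set Implicit Arguments.
Unset Strict Implicit.
Unset Printing Implicit Defensive.

Local Open Scope classical_set_scope.
Local Open Scope ring_scope.

(** GDA and OGDA are C^1 maps whose derivatives are invertible everywhere: for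
    GDA because alpha times the Hessian is a strict contraction, for OGDA
    because the Hessian is invertible. For such a map h the center-stable
    manifold theorem can be replaced by a cone argument. At an unstable fixed
    point p, a triangular form of the Jacobian yields seminorms u and c such
    that the cone c <= u is mapped into itself with u growing by a factor
    greater than 1; this persists for differences h x - h y near p. Two distinct
    points whose orbits both stay near p therefore differ by a vector outside
    the cone, so these points form a Lipschitz graph over a hyperplane, which is
    null. Countably many such graphs and their preimages under the iterates of
    h, which are null since h has locally Lipschitz inverses, cover the set of
    points converging to an unstable fixed point. *)

(** * Null sets *)

Lemma row_norm_ge (R : realType) N (x : 'rV[R]_N) j : `|x 0 j| <= `|x|.
Proof.
rewrite [leRHS]mx_normrE; exact: (le_bigmax _ (fun ij => `|x ij.1 ij.2|) (0, j)).
Qed.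

Lemma row_norm_le (R : realType) N (x : 'rV[R]_N) c :
  0 <= c -> (forall j, `|x 0 j| <= c) -> `|x| <= c.
Proof.
move=> c0 xc; rewrite [leLHS]mx_normrE; apply: bigmax_le => // -[i j] _ /=.
by rewrite ord1.
Qed.

(* N-dimensional Hausdorff measure zero. Covers by arbitrary sets of given
   diameter are transported by Lipschitz maps without cutting boxes into cubes. *)
Definition hausdorff_null (R : realType) N (X : set 'rV[R]_N) : Prop :=
  forall e : R, 0 < e -> exists (S : nat -> set 'rV[R]_N) (r : nat -> R),
    [/\ X `<=` \bigcup_k S k,
        forall k x y, S k x -> S k y -> `|x - y| <= r k,
        forall k, 0 <= r k
      & forall s : seq nat, uniq s -> \sum_(k <- s) r k ^+ N <= e].

(** Covers may be indexed by any countable type: a number that encodes no index receives the empty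
    set and diameter bound 0, which costs nothing because [0 ^+ N = 0] for positive [N]. *)
Lemma hausdorff_null_count (R : realType) N (X : set 'rV[R]_N) : (0 < N)%N ->
  (forall e : R, 0 < e ->
   exists (I : countType) (S : I -> set 'rV[R]_N) (r : I -> R),
    [/\ X `<=` \bigcup_k S k,
        forall k x y, S k x -> S k y -> `|x - y| <= r k,
        forall k, 0 <= r k
      & forall s : seq I, uniq s -> \sum_(k <- s) r k ^+ N <= e]) ->
  hausdorff_null X.
Proof.
move=> N0 HX e /HX[I [S [r [XS Sr r0 rs]]]].
exists (fun k => if pickle_inv k is Some i then S i else set0).
exists (fun k => if @pickle_inv I k is Some i then r i else 0); split.
- move=> x /XS[i _ Sx]; exists (pickle i) => //.
  by rewrite pickleK_inv.
- by move=> k x y; case: pickle_inv => // i; exact: Sr.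
- by move=> k; case: pickle_inv.
- move=> s us.
  have -> : \sum_(k <- s) (if @pickle_inv I k is Some i then r i else 0) ^+ N =
            \sum_(k <- pmap (@pickle_inv I) s) r k ^+ N.
    elim: s {us} => [|k s IH]; first by rewrite !big_nil.
    rewrite big_cons IH /=; case: pickle_inv => [i|] /=.
      by rewrite big_cons.
    by rewrite expr0n eqn0Ngt N0 add0r.
  by apply: rs; apply: (pmap_uniq (@pickle_invK I)).
Qed.

Lemma sum_half_pow_le (R : realType) (e : R) M : 0 <= e ->
  \sum_(i < M) e / 2 ^+ i.+1 <= e.
Proof.
move=> e0; suff -> : \sum_(i < M) e / 2 ^+ i.+1 = e - e / 2 ^+ M.
  by rewrite lerBlDr lerDl divr_ge0 // exprn_ge0.
elim: M => [|M IH]; first by rewrite big_ord0 expr0 divr1 subrr.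
by rewrite big_ord_recr /= IH exprS; field; rewrite expf_neq0.
Qed.

Lemma hausdorff_null_bigcup_nat (R : realType) N (X : nat -> set 'rV[R]_N) :
  (0 < N)%N -> (forall i, hausdorff_null (X i)) ->
  hausdorff_null (\bigcup_i X i).
Proof.
move=> N0 HX; apply: hausdorff_null_count => // e e0.
have eh i : 0 < e / 2 ^+ i.+1 by rewrite divr_gt0 // exprn_gt0.
have := fun i => HX i _ (eh i).
move=> /choice[S] /choice[r H].
exists (nat * nat)%type, (fun k => S k.1 k.2), (fun k => r k.1 k.2); split.
- move=> x [i _ Xx]; have [/(_ _ Xx) [j _ Sx] _ _ _] := H i.
  by exists (i, j).
- by move=> [i j] x y; have [_ + _ _] := H i; exact.
- by move=> [i j]; have [_ _ + _] := H i; exact.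
- move=> s us.
  (* [M] exceeds every first index in [s], so the finite sum splits into [M] rows, and row [i] costs
     at most [e / 2 ^+ i.+1]. *)
  pose M := \max_(k <- s) k.1.+1.
  have sM k : k \in s -> (k.1 < M)%N.
    by move=> ks; rewrite /M (big_rem _ ks) /= leq_maxl.
  apply: le_trans (sum_half_pow_le M (ltW e0)).
  have -> : \sum_(k <- s) r k.1 k.2 ^+ N =
      \sum_(i < M) \sum_(k <- s | k.1 == i :> nat) r k.1 k.2 ^+ N.
    under [RHS]eq_bigr do rewrite big_mkcond.
    rewrite exchange_big /= big_seq [RHS]big_seq.
    apply: eq_bigr => k ks.
    rewrite -big_mkcond (big_pred1 (Ordinal (sM k ks))) //.
  apply: ler_sum => i _.
  have -> : \sum_(k <- s | k.1 == i :> nat) r k.1 k.2 ^+ N =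
     \sum_(j <- [seq k.2 | k <- s & k.1 == i :> nat]) r i j ^+ N.
    by rewrite big_map big_filter; apply: eq_bigr => k /eqP ->.
  have [_ _ _ + ] := H i; apply; rewrite map_inj_in_uniq ?filter_uniq //.
  move=> [a b] [c d]; rewrite !mem_filter /= => /andP[/eqP-> _] /andP[/eqP-> _].
  by move=> ->.
Qed.

Lemma hausdorff_null_sub (R : realType) N (X Y : set 'rV[R]_N) :
  X `<=` Y -> hausdorff_null Y -> hausdorff_null X.
Proof.
move=> XY HY e /HY[S [r [YS Sr r0 rs]]]; exists S, r; split => //.
exact: subset_trans YS.
Qed.

Lemma hausdorff_null0 (R : realType) N : (0 < N)%N ->
  hausdorff_null (@set0 'rV[R]_N).
Proof.
move=> N0 e e0; exists (fun=> set0), (fun=> 0); split => // s _.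
by rewrite big1 ?ltW // => i _; rewrite expr0n eqn0Ngt N0.
Qed.

Lemma hausdorff_null_bigcup (R : realType) N (I : countType) (D : set I)
    (X : I -> set 'rV[R]_N) :
  (0 < N)%N -> (forall i, D i -> hausdorff_null (X i)) ->
  hausdorff_null (\bigcup_(i in D) X i).
Proof.
move=> N0 HX.
pose Y k := if @pickle_inv I k is Some i then
  (if `[< D i >] then X i else set0) else set0.
apply: (@hausdorff_null_sub _ _ _ (\bigcup_k Y k)).
  move=> x [i Di Xx]; exists (pickle i) => //.
  by rewrite /Y pickleK_inv asboolT.
apply: hausdorff_null_bigcup_nat => // k; rewrite /Y.
case: pickle_inv => [i|]; last exact: hausdorff_null0.
by case: asboolP => [/HX|_] //; exact: hausdorff_null0.
Qed.

Lemma hausdorff_null_lipschitz_preimage (R : realType) N (X V : set 'rV[R]_N)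
    (h : 'rV[R]_N -> 'rV[R]_N) (C : R) :
  (forall x y, V x -> V y -> `|x - y| <= C * `|h x - h y|) ->
  hausdorff_null X -> hausdorff_null (V `&` h @^-1` X).
Proof.
move=> hC HX e e0.
(* [C] may have any sign; [K] is a positive constant above it, by which one can divide. *)
pose K := `|C| + 1.
have K0 : 0 < K by rewrite ltr_pwDr.
have KN0 : 0 < K ^+ N by rewrite exprn_gt0.
have [S [r [XS Sr r0 rs]]] := HX _ (divr_gt0 e0 KN0).
exists (fun k => V `&` h @^-1` S k), (fun k => K * r k); split.
- by move=> x [Vx /XS[k _ Sk]]; exists k.
- move=> k x y [Vx Sx] [Vy Sy]; apply: (le_trans (hC _ _ Vx Vy)).
  apply: (@le_trans _ _ (K * `|h x - h y|)).
    by rewrite ler_wpM2r // /K; apply: (le_trans (ler_norm _)); rewrite lerDl.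
  by rewrite ler_wpM2l ?(ltW K0) //; exact: Sr.
- by move=> k; rewrite mulr_ge0 // ltW.
- move=> s us; under eq_bigr do rewrite exprMn.
  rewrite -mulr_sumr mulrC -ler_pdivlMr //; exact: rs.
Qed.

(** A set of diameter at most [r k] lies in the sup-norm ball of radius [r k] around any of its
    points, a cube of volume [(2 * r k) ^+ N]; hence the factor [2 ^+ N]. *)
Lemma hausdorff_null_lebesgue_null (R : realType) N (X : set 'rV[R]_N) :
  (0 < N)%N -> hausdorff_null X -> lebesgue_null X.
Proof.
move=> N0 HX; rewrite /lebesgue_null /lebesgue_outer_measure.
apply/eqP; rewrite eq_le; apply/andP; split; last first.
  apply: le_ereal_inf_tmp => _ [P [a [b [ab _ ->]]]].
  apply: nneseries_ge0 => k _ Pk; rewrite lee_fin.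
  by apply: prodr_ge0 => i _; rewrite subr_ge0 ab.
apply/lee_addgt0Pr => e e0; rewrite add0e.
have c0 : 0 < 2 ^+ N :> R by rewrite exprn_gt0.
have [S [r [XS Sr r0 rs]]] := HX _ (divr_gt0 e0 c0).
(* The centres of the cubes; an empty [S k] gets the placeholder 0. *)
have : forall k, exists x, S k !=set0 -> S k x.
  move=> k; have [[x Sx]|H] := pselect (S k !=set0); first by exists x.
  by exists 0 => /H.
move=> /choice[c Sc].
apply: (@le_trans _ _ (\sum_(k <oo | predT k) (\prod_(i < N)
    ((c k + const_mx (r k)) 0 i - (c k - const_mx (r k)) 0 i))%:E)%E).
  apply: ereal_inf_lbound; exists predT.
  exists (fun k => c k - const_mx (r k)), (fun k => c k + const_mx (r k)).
  split => // [k i _|x /XS[k _ Sx]].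
    by rewrite !mxE lerD2l ge0_cp.
  exists k => // i; rewrite !mxE.
  have Scx : S k (c k) by apply: Sc; exists x.
  have := le_trans (row_norm_ge (x - c k) i) (Sr _ _ _ Sx Scx).
  by rewrite !mxE ler_norml => /andP[? ?]; apply/andP; split; lra.
apply: lime_le.
  by apply: is_cvg_nneseries => k _ _; rewrite lee_fin; apply: prodr_ge0 => i _;
     rewrite !mxE; have := r0 k; lra.
apply: nearW => n; rewrite sumEFin lee_fin.
under eq_bigr => k _.
  rewrite (eq_bigr (fun=> 2 * r k)) => [|i _]; last by rewrite !mxE; lra.
  rewrite prodr_const card_ord exprMn; over.
rewrite -mulr_sumr mulrC -ler_pdivlMr //.
by rewrite big_mkord -(big_mkord predT (fun k => r k ^+ N)) rs // iota_uniq.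
Qed.

(** [psi] maps [W] into an [n]-dimensional cube, which is cut into [M.+1 ^ n] cells of side [w]. The
    piece of [W] over a cell has diameter at most [K * w], so the total cost in dimension [n.+1] is
    [C / M.+1%:R], arbitrarily small. *)
Lemma hausdorff_null_expanding (R : realType) n (W : set 'rV[R]_n.+1)
    (psi : 'rV[R]_n.+1 -> 'rV[R]_n) (b K : R) :
  0 < b -> 0 <= K -> (forall x, W x -> `|psi x| < b) ->
  (forall x y, W x -> W y -> `|x - y| <= K * `|psi x - psi y|) ->
  hausdorff_null W.
Proof.
move=> b0 K0 Wb WK; apply: hausdorff_null_count => // e e0.
pose C := (K * (2 * b)) ^+ n.+1.
have C0 : 0 <= C by rewrite exprn_ge0 // !mulr_ge0 // ltW.
pose M := Num.truncn (C / e).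
have CM : C / e < M.+1%:R.
  by have /andP[] := truncn_itv (divr_ge0 C0 (ltW e0)).
pose w := 2 * b / M.+1%:R.
have M0 : 0 < M.+1%:R :> R by rewrite ltr0n.
have w0 : 0 < w by rewrite divr_gt0 // mulr_gt0.
exists {ffun 'I_n -> 'I_M.+1}.
exists (fun g : {ffun 'I_n -> 'I_M.+1} => [set x | W x /\ forall j,
  (g j)%:R * w <= psi x 0 j + b <= (g j).+1%:R * w]).
exists (fun=> K * w); split.
- move=> x Wx.
  pose g := [ffun j => @inord M (Num.truncn ((psi x 0 j + b) / w))].
  exists g => //=; split => // j; rewrite /g ffunE.
  have := le_lt_trans (row_norm_ge (psi x) j) (Wb _ Wx).
  rewrite ltr_norml => /andP[xb1 xb2].
  have q0 : 0 <= (psi x 0 j + b) / w by rewrite divr_ge0 ?(ltW w0) //; lra.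
  have /andP[q1 q2] := truncn_itv q0.
  (* The strict bound on [psi x] keeps the cell index within range, so that [inord] returns it
     unchanged. *)
  have qM : (Num.truncn ((psi x ord0 j + b) / w) < M.+1)%N.
    rewrite -(ltr_nat R); apply: (le_lt_trans q1).
    rewrite ltr_pdivrMr // /w mulrCA divff ?gt_eqF // mulr1; lra.
  rewrite inordK //; apply/andP; split; first by rewrite -ler_pdivlMr.
  by rewrite -ler_pdivrMr // ltW.
- move=> g x y [Wx gx] [Wy gy]; apply: (le_trans (WK _ _ Wx Wy)).
  rewrite ler_wpM2l //; apply: row_norm_le; first exact: ltW.
  move=> j; rewrite !mxE ler_norml.
  have := gx j; have := gy j; rewrite -natr1 mulrDl mul1r.
  by move=> /andP[? ?] /andP[? ?]; apply/andP; split; lra.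
- by move=> _; rewrite mulr_ge0 // ltW.
- move=> s us; rewrite big_const_seq count_predT iter_addr_0.
  have -> : K * w = K * (2 * b) / M.+1%:R by rewrite /w mulrA.
  rewrite expr_div_n -/C.
  have sM : (size s <= M.+1 ^ n)%N.
    by rewrite -(card_uniqP us) (leq_trans (max_card _)) // card_ffun !card_ord.
  have H0 : 0 <= C / M.+1%:R ^+ n.+1 by rewrite divr_ge0 // exprn_ge0 // ltW.
  apply: (@le_trans _ _ (C / M.+1%:R ^+ n.+1 * M.+1%:R ^+ n)).
    by rewrite -[leLHS]mulr_natr ler_wpM2l // -natrX ler_nat.
  rewrite exprS invfM mulrA -(mulrA (C / _)) mulVf ?expf_neq0 ?gt_eqF // mulr1.
  by rewrite ler_pdivrMr // mulrC -ler_pdivrMr // ltW.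
Qed.

(** * Strict differentiability *)

(** The error is uniform over pairs of points near [p], unlike in Fréchet differentiability: this is
    what compares two orbits with each other, neither of them being [p]. *)
Definition strictly_differentiable (R : realType) M N
    (h : 'rV[R]_M -> 'rV[R]_N) (p : 'rV[R]_M) (A : 'M[R]_(M, N)) : Prop :=
  forall e : R, 0 < e -> exists2 d : R, 0 < d & forall x y,
    `|x - p| < d -> `|y - p| < d ->
    `|h x - h y - (x - y) *m A| <= e * `|x - y|.

Lemma mulmx_norm_le (R : realType) N M (v : 'rV[R]_N) (A : 'M[R]_(N, M)) :
  `|v *m A| <= N%:R * `|A| * `|v|.
Proof.
apply: row_norm_le => [|j]; first by rewrite !mulr_ge0.
rewrite mxE; apply: (le_trans (ler_norm_sum _ _ _)).
have -> : N%:R * `|A| * `|v| = \sum_(i < N) `|v| * `|A|.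
  by rewrite sumr_const card_ord -[RHS]mulr_natl mulrAC mulrA.
apply: ler_sum => i _; rewrite normrM ler_pM ?row_norm_ge //.
rewrite [leRHS]mx_normrE; exact: (le_bigmax _ (fun ij => `|A ij.1 ij.2|) (i, j)).
Qed.

(** Taking [y = p] gives ordinary differentiability, and uniqueness of the differential identifies
    [A]. *)
Lemma jacobian_strictly_differentiable (R : realType) N
    (h : 'rV[R]_N -> 'rV[R]_N) p A :
  strictly_differentiable h p A -> 'J h p = A.
Proof.
move=> hA; pose df : {linear 'rV[R]_N -> 'rV[R]_N} := mulmxr A.
have dfc : continuous df.
  apply/linear_bounded_continuous/linear_boundedP.
  exists (N%:R * `|A|); split; first exact: num_real.
  move=> M NM x; apply: (le_trans (mulmx_norm_le _ _)).
  by rewrite ler_wpM2r // ltW.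
rewrite /jacobian (@diff_unique _ _ _ h df p) //.
  by apply/row_matrixP => i; rewrite !rowE mul_rV_lin1.
apply/eqaddoP => _/posnumP[e].
have [d d0 H] := hA e%:num (gt0 e).
near=> v => /=.
rewrite !fctE /= -[X in `|X|]/(h (v + p) - (h p + v *m A)).
have := H (v + p) p; rewrite addrK subrr normr0 opprD addrA; apply => //.
Unshelve. all: by end_near. Qed.

(** An invertible [A] satisfies [|v| <= C * |v *m A|]; allowing an error of [(2 * C)^-1 * |x - y|]
    loses only half of [|x - y|]. This is the part of the inverse function theorem that null
    preimages require. *)
Lemma strictly_differentiable_expanding (R : realType) N
    (h : 'rV[R]_N -> 'rV[R]_N) p A :
  strictly_differentiable h p A -> A \in unitmx ->
  exists2 d : R, 0 < d & exists C : R, forall x y,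
    `|x - p| < d -> `|y - p| < d -> `|x - y| <= C * `|h x - h y|.
Proof.
move=> hA uA; pose C := N%:R * `|invmx A| + 1.
have C0 : 0 < C by rewrite ltr_pwDr // mulr_ge0.
have HC (v : 'rV[R]_N) : `|v| <= C * `|v *m A|.
  rewrite -[X in `|X| <= _](mulmxK uA).
  refine (le_trans (mulmx_norm_le (v *m A) (invmx A)) _).
  by rewrite ler_wpM2r // lerDl.
have [d d0 H] := hA (2 * C)^-1 ltac:(by rewrite invr_gt0 mulr_gt0).
exists d => //; exists (2 * C) => x y xd yd.
have h1 := HC (x - y).
have h2 : `|(x - y) *m A| <= `|h x - h y| + (2 * C)^-1 * `|x - y|.
  apply: (le_trans _ (lerD (lexx _) (H x y xd yd))).
  by rewrite -[X in `|X| <= _](subKr (h x - h y)) (le_trans (ler_normB _ _)).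
have h3 : C * ((2 * C)^-1 * `|x - y|) = `|x - y| / 2.
  by field; rewrite gt_eqF.
have := le_trans h1 (ler_wpM2l (ltW C0) h2).
rewrite mulrDr h3 => ?; lra.
Qed.

(* These countably many balls stand in for a Lindelöf subcover, so that no local
   radius has to be chosen. *)
Definition rat_ball (R : realType) N (k : 'rV[rat]_N * nat) : set 'rV[R]_N :=
  [set x | `|x - map_mx ratr k.1| < k.2.+1%:R^-1].

Lemma rat_ball_nbhs (R : realType) N (p : 'rV[R]_N) (d : R) : 0 < d ->
  exists2 k, rat_ball k p & forall x, rat_ball k x -> `|x - p| < d.
Proof.
(* The radius [M.+1%:R^-1] is below [d / 2], so two points of such a ball are less than [d]
   apart. *)
move=> d0; pose M := Num.truncn (2 / d).
have dM : 2 / d < M.+1%:R.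
  by have /andP[] := truncn_itv (divr_ge0 (ler0n R 2) (ltW d0)).
have M0 : 0 < M.+1%:R :> R by rewrite ltr0n.
pose r : R := M.+1%:R^-1 / 2.
have r0 : 0 < r by rewrite divr_gt0 // invr_gt0.
have : forall j, exists q : rat, `|p 0 j - ratr q| <= r.
  move=> j; have [|q] := @rat_in_itvoo R (p 0 j - r) (p 0 j + r); first lra.
  rewrite in_itv /= => /andP[? ?]; exists q; rewrite ler_norml.
  by apply/andP; split; lra.
move=> /choice[q qp].
pose k := (\row_j q j : 'rV[rat]_N, M).
have kp : rat_ball k p.
  rewrite /rat_ball /=; apply: (@le_lt_trans _ _ r).
    by apply: row_norm_le; [exact: ltW | move=> j; rewrite !mxE].
  by rewrite /r ltr_pdivrMr // ltr_pMr ?invr_gt0 // ltr1n.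
exists k => // x kx.
have -> : x - p = (x - map_mx ratr k.1) - (p - map_mx ratr k.1).
  by rewrite opprB addrA subrK.
apply: (le_lt_trans (ler_normB _ _)).
apply: (lt_le_trans (ltrD kx kp)); rewrite /k /=.
have : M.+1%:R^-1 < d / 2 :> R.
  by rewrite -[ltRHS]invrK ltf_pV2 ?posrE ?invr_gt0 ?divr_gt0 // invf_div.
by move=> Md; rewrite [leRHS]splitr lerD // ltW.
Qed.

Lemma hausdorff_null_preimage (R : realType) N (h : 'rV[R]_N -> 'rV[R]_N)
    (J : 'rV[R]_N -> 'M[R]_N) (X : set 'rV[R]_N) : (0 < N)%N ->
  (forall p, strictly_differentiable h p (J p)) ->
  (forall p, J p \in unitmx) ->
  hausdorff_null X -> hausdorff_null (h @^-1` X).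
Proof.
move=> N0 hJ uJ nX.
(* Each point has a rational ball on which [h] has a Lipschitz inverse, hence one in [D]; there are
   only countably many of them. *)
pose D := [set k : 'rV[rat]_N * nat |
  hausdorff_null (rat_ball k `&` h @^-1` X)].
apply: (@hausdorff_null_sub _ _ _
  (\bigcup_(k in D) (rat_ball k `&` h @^-1` X))); last first.
  by apply: hausdorff_null_bigcup.
move=> p Xp.
have [d d0 [C HC]] := strictly_differentiable_expanding (hJ p) (uJ p).
have [k kp kd] := rat_ball_nbhs p d0.
exists k => //; rewrite /D /=.
apply: (@hausdorff_null_lipschitz_preimage _ _ _ _ _ C) => // x y kx ky.
by apply: HC; exact: kd.
Qed.

(** * The unstable cone *)

(** Homogeneity is asked as an inequality, which is easier to check for maxima; [seminormZ] recovers
    the equality. *)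
Definition seminorm (R : realType) N (f : 'rV[R]_N -> R) : Prop :=
  (forall x y, f (x + y) <= f x + f y) /\
  (forall a x, f (a *: x) <= `|a| * f x).

Lemma seminorm_ge0 (R : realType) N (f : 'rV[R]_N -> R) x :
  seminorm f -> 0 <= f x.
Proof.
move=> [fD fZ]; have f0 := fZ 0 0; rewrite scaler0 normr0 mul0r in f0.
have := fD 0 0; rewrite addr0 => f0'.
have := fD x (- x); rewrite subrr -scaleN1r.
have := fZ (-1) x; rewrite normrN1 mul1r; lra.
Qed.

Lemma seminormZ (R : realType) N (f : 'rV[R]_N -> R) a x :
  seminorm f -> f (a *: x) = `|a| * f x.
Proof.
move=> fS; apply/eqP; rewrite eq_le fS.2 /=.
have [->|a0] := eqVneq a 0; first by rewrite normr0 mul0r seminorm_ge0.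
rewrite -ler_pdivlMl ?normr_gt0 // -normfV.
by rewrite -{1}(scalerK a0 x) fS.2.
Qed.

Lemma seminormN (R : realType) N (f : 'rV[R]_N -> R) x :
  seminorm f -> f (- x) = f x.
Proof. by move=> fS; rewrite -scaleN1r seminormZ // normrN1 mul1r. Qed.

Section ComplexModulus.
Variable R : realType.
Implicit Types z w : R[i].
Local Notation normc := (@Normc.normc R).

Lemma normc_ge0 z : 0 <= normc z.
Proof. by case: z => a b; exact: sqrtr_ge0. Qed.

Lemma normc_sum (I : finType) (P : pred I) (F : I -> R[i]) :
  normc (\sum_(i | P i) F i) <= \sum_(i | P i) normc (F i).
Proof.
elim/big_rec2: _ => [|i y z _ H]; first by rewrite Normc.normc0.
by apply: (le_trans (le_normcD _ _)); rewrite lerD2l.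
Qed.

Lemma normc_dist z w : `|normc z - normc w| <= normc (z - w).
Proof.
have H (x y : R[i]) : normc x - normc y <= normc (x - y).
  by rewrite lerBlDr -{1}(subrK y x); exact: le_normcD.
rewrite ler_norml H andbT lerNl opprB.
by apply: (le_trans (H _ _)); rewrite -opprB normcN.
Qed.

Lemma normc_real (x : R) : normc (real_complex R x) = `|x|.
Proof. by rewrite /= expr0n /= addr0 sqrtr_sqr. Qed.

Lemma normc_le (x y : R) : normc (Complex x y) <= `|x| + `|y|.
Proof.
rewrite /= -(@ler_pXn2r _ 2) ?nnegrE ?sqrtr_ge0 ?addr_ge0 //.
rewrite sqr_sqrtr ?addr_ge0 ?sqr_ge0 // sqrrD !real_normK ?num_real //.
by rewrite addrAC lerDl mulrn_wge0 // mulr_ge0.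
Qed.

Lemma normcX z k : normc (z ^+ k) = normc z ^+ k.
Proof.
elim: k => [|k IH]; first by rewrite !expr0 Normc.normc1.
by rewrite !exprS Normc.normcM IH.
Qed.

End ComplexModulus.

Lemma unitmx_diag (F : fieldType) N (w : 'rV[F]_N) :
  (forall i, w 0 i != 0) -> diag_mx w \in unitmx.
Proof. by move=> w0; rewrite unitmxE det_diag unitfE; apply/prodf_neq0. Qed.

Lemma mulmx_diag_rescale (F : fieldType) N (T : 'M[F]_N) (w : 'rV_N) :
  (forall i, w 0 i != 0) ->
  T *m diag_mx w =
  diag_mx w *m \matrix_(i, j) ((w 0 i)^-1 * T i j * w 0 j).
Proof.
move=> w0; rewrite mul_mx_diag mul_diag_mx; apply/matrixP => i j; rewrite !mxE.
by rewrite -mulrA mulVKf.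
Qed.

(** Bernoulli's inequality makes the powers of any [x > 1] unbounded. *)
Lemma geometric_bound (R : realType) (x y B : R) : 0 < x -> 0 < y ->
  (forall k, x ^+ k * y <= B) -> x <= 1.
Proof.
move=> x0 y0 H; rewrite leNgt; apply/negP => x1.
pose d := x - 1; have d0 : 0 < d by rewrite subr_gt0.
have bern k : 1 + k%:R * d <= x ^+ k.
  elim: k => [|k IH]; first by rewrite mul0r addr0 expr0.
  rewrite exprS; apply: (@le_trans _ _ (x * (1 + k%:R * d))); last first.
    by rewrite ler_pM2l.
  have -> : x = 1 + d by rewrite /d addrC subrK.
  have : 0 <= k%:R * d * d by rewrite !mulr_ge0 // ltW.
  rewrite -natr1; lra.
have B0 : 0 < B by apply: lt_le_trans (H 0%N); rewrite expr0 mul1r.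
have Bd0 : 0 <= B / (d * y) by rewrite divr_ge0 ?mulr_ge0 // ltW.
have /andP[_] := truncn_itv Bd0.
set k := (Num.truncn _).+1.
rewrite ltr_pdivrMr ?mulr_gt0 // => Bk.
have := H k; rewrite leNgt => /negP; apply; apply: (lt_le_trans Bk).
rewrite mulrA ler_pM2r //; apply: le_trans (bern k).
by rewrite lerDr.
Qed.

(** * Seminorms adapted to a real matrix through its complex triangular form *)

Section Cone.
Variables (R : realType) (N : nat) (A : 'M[R]_N).
Local Notation normc := (@Normc.normc R).
Local Notation toC := (real_complex R).
Local Notation AC := (map_mx toC A).

(* Schur triangularization, with the basis rescaled geometrically to make the
   off-diagonal part as small as wanted. *)
Lemma almost_diagonal : (0 < N)%N -> exists a : 'I_N -> R,
  forall eta : R, 0 < eta -> exists (Q T : 'M[R[i]]_N),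
  [/\ Q \in unitmx, AC *m Q = Q *m T,
      forall j, normc (T j j) = a j
    & forall i j, i != j -> normc (T i j) <= eta].
Proof.
move=> N0; have [P Pu Ptrig] := Schur AC N0.
have uP := unitarymx_unit Pu.
pose T := P *m AC *m invmx P.
have Ttrig (i j : 'I_N) : (i < j)%N -> T i j = 0.
  move: Ptrig; rewrite /similar_to /= conjumx // => /is_trig_mxP; exact.
exists (fun j => normc (T j j)) => eta eta0.
pose tau := \sum_i \sum_j normc (T i j).
have tau0 : 0 <= tau.
  by apply: sumr_ge0 => i _; apply: sumr_ge0 => j _; exact: normc_ge0.
have Ttau i j : normc (T i j) <= tau.
  rewrite /tau (bigD1 i) //= (bigD1 j) //= -addrA lerDl addr_ge0 //.
    by apply: sumr_ge0 => k _; exact: normc_ge0.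
  by apply: sumr_ge0 => l _; apply: sumr_ge0 => k _; exact: normc_ge0.
(* Rescaling by powers of [t] divides the entry [(i, j)] with [j < i] by [t ^+ (i - j)], which is at
   least [t], and [tau <= eta * t]. The diagonal is unchanged. *)
pose t := 1 + tau / eta.
have t1 : 1 <= t by rewrite lerDl divr_ge0 // ltW.
have t0 : 0 < t by apply: lt_le_trans t1.
have tC0 : toC t != 0 by rewrite fmorph_eq0 gt_eqF.
pose w := \row_(j < N) (toC t) ^+ j.
have w0 j : w 0 j != 0 by rewrite mxE expf_neq0.
exists (invmx P *m diag_mx w), (\matrix_(i, j) ((w 0 i)^-1 * T i j * w 0 j)).
split.
- by rewrite unitmx_mul unitmx_inv uP unitmx_diag.
- by rewrite -mulmxA -mulmx_diag_rescale // /T !mulmxA mulVmx // mul1mx.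
- by move=> j; rewrite mxE mulrAC mulVf ?mul1r.
- move=> i j ij; rewrite mxE.
  have [ltij|ltji|/val_inj ijE] := ltngtP i j; last by rewrite ijE eqxx in ij.
    by rewrite Ttrig // mulr0 mul0r Normc.normc0 ltW.
  have -> : (w 0 i)^-1 * T i j * w 0 j = T i j / toC t ^+ (i - j).
    rewrite [w 0 i]mxE [w 0 j]mxE.
    rewrite -{1}(subnK (ltnW ltji)) exprD invfM mulrAC mulrC.
    by rewrite -mulrA mulVf ?mulr1 // expf_neq0.
  rewrite Normc.normcM Normc.normcV normcX normc_real gtr0_norm //.
  rewrite ler_pdivrMr ?exprn_gt0 //.
  apply: (le_trans (Ttau i j)).
  apply: (@le_trans _ _ (eta * t)).
    by rewrite /t mulrDr mulr1 mulrCA divff ?gt_eqF // mulr1 lerDr ltW.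
  rewrite ler_pM2l // -{1}(expr1 t) ler_weXn2l //.
  by rewrite subn_gt0.
Qed.

(** [q j v] is the modulus of the [j]-th complex coordinate of [v] in a basis where [A] is almost
    diagonal. The moduli [a] are fixed before [eta], so that [eta] can later be chosen from their
    distance to 1; [q] and [K] depend on [eta]. *)
Lemma almost_diagonal_seminorms : (0 < N)%N -> exists a : 'I_N -> R,
  forall eta : R, 0 < eta -> exists q : 'I_N -> 'rV[R]_N -> R,
  [/\ forall j, seminorm (q j),
      exists2 K : R, 0 < K & (forall j v, q j v <= K * `|v|) /\
        (forall v m, (forall j, q j v <= m) -> `|v| <= K * m)
    & forall v m, (forall j, q j v <= m) ->
        forall j, `|q j (v *m A) - a j * q j v| <= eta * m].
Proof.
move=> N0; have [a Ha] := almost_diagonal N0; exists a => eta eta0.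
have NR0 : 0 < N%:R :> R by rewrite ltr0n.
have [Q [T [uQ AQ Tdiag Toff]]] := Ha _ (divr_gt0 eta0 NR0).
pose z (v : 'rV[R]_N) := map_mx toC v *m Q.
exists (fun j v => normc (z v 0 j)); split.
- move=> j; split=> [x y|b x].
    rewrite /z map_mxD mulmxDl mxE; exact: le_normcD.
  by rewrite /z map_mxZ -scalemxAl mxE Normc.normcM normc_real.
- pose s (B : 'M[R[i]]_N) := \sum_i \sum_j normc (B i j).
  have s0 B : 0 <= s B.
    by apply: sumr_ge0 => i _; apply: sumr_ge0 => j _; exact: normc_ge0.
  have sB (B : 'M[R[i]]_N) j : \sum_i normc (B i j) <= s B.
    rewrite /s exchange_big /= [leRHS](bigD1 j) //= lerDl.
    by apply: sumr_ge0 => i _; apply: sumr_ge0 => k _; exact: normc_ge0.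
  have bound (B : 'M[R[i]]_N) (x : 'rV[R[i]]_N) m j :
      (forall i, normc (x 0 i) <= m) -> normc ((x *m B) 0 j) <= s B * m.
    move=> xm; rewrite mxE; apply: (le_trans (normc_sum _ _)).
    have m0 : 0 <= m by apply: le_trans (xm j); exact: normc_ge0.
    apply: (@le_trans _ _ (\sum_i normc (B i j) * m)).
      apply: ler_sum => i _; rewrite Normc.normcM mulrC ler_wpM2l //.
      exact: normc_ge0.
    by rewrite -mulr_suml ler_wpM2r.
  exists (1 + s Q + s (invmx Q)).
    by rewrite ltr_pwDl // ltr_pwDl.
  split=> [j v|v m qm].
    apply: (@le_trans _ _ (s Q * `|v|)).
      apply: bound => i; rewrite mxE normc_real; exact: row_norm_ge.
    by rewrite ler_wpM2r // -addrA addrCA lerDl addr_ge0.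
  have m0 : 0 <= m.
    by apply: le_trans (qm (Ordinal N0)); exact: normc_ge0.
  apply: (@le_trans _ _ (s (invmx Q) * m)); last first.
    by rewrite ler_wpM2r // lerDr addr_ge0.
  apply: row_norm_le => [|j]; first by rewrite mulr_ge0.
  have -> : `|v 0 j| = normc ((z v *m invmx Q) 0 j).
    by rewrite mulmxK // mxE normc_real.
  exact: bound.
- move=> v m qm j.
  have m0 : 0 <= m by apply: le_trans (qm j); exact: normc_ge0.
  have -> : z (v *m A) = z v *m T.
    by rewrite /z map_mxM -mulmxA AQ mulmxA.
  have -> : a j * normc (z v 0 j) = normc (z v 0 j * T j j).
    by rewrite Normc.normcM Tdiag mulrC.
  apply: (le_trans (normc_dist _ _)).
  rewrite mxE (bigD1 j) //= addrAC subrr add0r.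
  apply: (le_trans (normc_sum _ _)).
  apply: (@le_trans _ _ (\sum_(i < N) eta / N%:R * m)); last first.
    by rewrite sumr_const card_ord -[leLHS]mulr_natr mulrAC divfK ?gt_eqF.
  rewrite [leRHS](bigD1 j) //= ler_wpDl //.
    by rewrite mulr_ge0 // ltW // divr_gt0.
  apply: ler_sum => i ij; rewrite Normc.normcM mulrC.
  by rewrite ler_pM ?normc_ge0 // Toff.
Qed.

(** Splitting a complex eigenvector [w] into real and imaginary parts expresses [z ^+ k *: w] by two
    real orbits, so the powers of [normc z / mu] stay bounded. *)
Lemma eigenvalue_growth (z : R[i]) (mu : R) (C : 'rV[R]_N -> R) :
  eigenvalue AC z -> 0 < mu ->
  (forall v k, `|iter k (mulmxr A) v| <= mu ^+ k * C v) -> normc z <= mu.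
Proof.
move=> /eigenvalueP[w wz w0] mu0 H.
have [z0|zn0] := eqVneq (normc z) 0; first by rewrite z0 ltW.
have zpos : 0 < normc z by rewrite lt_def zn0 normc_ge0.
pose a := map_mx (@complex.Re R) w; pose b := map_mx (@complex.Im R) w.
have wab : w = map_mx toC a + 'i%C *: map_mx toC b.
  by apply/matrixP => i j; rewrite !mxE [LHS]complexE.
have iterw k : z ^+ k *: w = map_mx toC (iter k (mulmxr A) a) +
    'i%C *: map_mx toC (iter k (mulmxr A) b).
  elim: k => [|k IH]; first by rewrite expr0 scale1r.
  rewrite exprSr -scalerA -wz scalemxAl IH /= !map_mxM mulmxDl.
  by rewrite -scalemxAl.
have [j wj] : exists j, w 0 j != 0 by apply/rV0Pn.
have wj0 : 0 < normc (w 0 j).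
  rewrite lt_def normc_ge0 andbT; apply: contra wj => /eqP/Normc.eq0_normc ->.
  exact: eqxx.
rewrite -[leRHS]mul1r -ler_pdivrMr //.
apply: (@geometric_bound _ _ (normc (w 0 j)) (C a + C b)) => [||k] //.
  by rewrite divr_gt0.
rewrite expr_div_n mulrAC ler_pdivrMr ?exprn_gt0 // mulrC [leRHS]mulrC mulrDr.
rewrite [leLHS]mulrC -normcX -Normc.normcM.
have -> : z ^+ k * w 0 j = Complex (iter k (mulmxr A) a 0 j)
                                   (iter k (mulmxr A) b 0 j).
  by have := congr1 (fun M : 'rV_N => M 0 j) (iterw k); rewrite !mxE => ->; simpc.
apply: (le_trans (normc_le _ _)).
by rewrite lerD // (le_trans _ (H _ k)) // row_norm_ge.
Qed.
End Cone.

(** [u] and [c] are the maxima of the adapted seminorms over the coordinates with [1 < a j] and over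
    the others. On the cone every [q j v] is at most [u v], so the off-diagonal error is at most
    [eta * u v]. *)
Lemma unstable_cone (R : realType) N (A : 'M[R]_N) (z : R[i]) :
  eigenvalue (map_mx (real_complex R) A) z -> 1 < Normc.normc z ->
  exists (u c : 'rV[R]_N -> R) (lam mu K : R),
  [/\ 1 <= mu, mu < lam & 0 < K] /\
  [/\ seminorm u, seminorm c,
      forall v, u v <= K * `|v| /\ c v <= K * `|v|,
      forall v m, u v <= m -> c v <= m -> `|v| <= K * m
    & forall v, c v <= u v -> lam * u v <= u (v *m A) /\ c (v *m A) <= mu * u v]
  /\ exists v, c v < u v.
Proof.
move=> zA z1.
have N0 : (0 < N)%N.
  by case: N A zA => // A /eigenvalueP[w _]; rewrite thinmx0 eqxx.
have [a Ha] := almost_diagonal_seminorms A N0.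
(* With [normc z] as base value, [1 < l0 <= normc z] holds without matching [z] to a diagonal
   entry. *)
pose l0 := \big[Num.min/Normc.normc z]_(j | 1 < a j) a j.
have l0z : l0 <= Normc.normc z by exact: bigmin_le_id.
have l01 : 1 < l0 by apply: lt_bigmin.
have l0a j : 1 < a j -> l0 <= a j by move=> aj; exact: bigmin_le_cond.
(* The rates become [lam = 1 + 3 * eta] and [mu = 1 + eta]. *)
pose eta := (l0 - 1) / 4.
have eta0 : 0 < eta by rewrite divr_gt0 // subr_gt0.
have etaE : l0 = 1 + 4 * eta by rewrite /eta mulrC divfK // addrC subrK.
have [q [qS [K K0 [qK Kq]] qA]] := Ha _ eta0.
have q0 j v : 0 <= q j v by apply: seminorm_ge0.
pose f (P : pred 'I_N) v := \big[Num.max/0]_(j | P j) q j v.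
have f0 P v : 0 <= f P v by exact: bigmax_ge_id.
have fge (P : pred 'I_N) j v : P j -> q j v <= f P v.
  by move=> Pj; exact: le_bigmax_cond.
have fle (P : pred 'I_N) v m :
    0 <= m -> (forall j, P j -> q j v <= m) -> f P v <= m.
  by move=> m0 qm; exact: bigmax_le.
have fS P : seminorm (f P).
  split=> [x y|b x]; apply: fle => [|j Pj]; rewrite ?addr_ge0 ?mulr_ge0 //.
    by apply: (le_trans ((qS j).1 x y)); rewrite lerD // fge.
  by apply: (le_trans ((qS j).2 b x)); rewrite ler_wpM2l // fge.
pose U := fun j => 1 < a j; pose u := f U; pose c := f (predC U).
have ucq v m : u v <= m -> c v <= m -> forall j, q j v <= m.
  move=> um cm j; have [Uj|nUj] := boolP (U j).
    by apply: le_trans um; exact: fge.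
  by apply: le_trans cm; exact: fge.
have cA v m : u v <= m -> c v <= m -> c (v *m A) <= (1 + eta) * m.
  move=> um cm; have qm := ucq _ _ um cm.
  have m0 : 0 <= m := le_trans (f0 _ _) um.
  apply: fle => [|j /=]; first by rewrite mulr_ge0 // addr_ge0 // ltW.
  rewrite /U -leNgt => aj; have := qA v m qm j; rewrite ler_norml => /andP[_].
  have : a j * q j v <= m.
    apply: (@le_trans _ _ (1 * q j v)); first by rewrite ler_wpM2r.
    by rewrite mul1r.
  lra.
exists u, c, (l0 - eta), (1 + eta), K; split; [|split].
- by split; lra.
- split=> [||v|v m um cm|v cu].
  + exact: fS.
  + exact: fS.
  + by split; (apply: fle => [|j _]; [by rewrite mulr_ge0 ?(ltW K0)|exact: qK]).
  + by apply: Kq; exact: ucq.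
  + split; last exact: cA.
    have qu := ucq v _ (lexx _) cu.
    have l0p : 0 < l0 by lra.
    (* Solved for [u v], the estimate becomes an upper bound on a maximum and can be checked
       coordinate by coordinate. *)
    suff : u v <= (u (v *m A) + eta * u v) / l0.
      by rewrite ler_pdivlMr //; lra.
    apply: fle => [|j Uj].
      rewrite divr_ge0 ?(ltW l0p) //; apply: addr_ge0; first exact: f0.
      by apply: mulr_ge0; [exact: ltW | exact: f0].
    rewrite ler_pdivlMr //.
    have := qA v _ qu j; rewrite ler_norml => /andP[+ _].
    have := ler_wpM2r (q0 j v) (l0a j Uj).
    have := fge U j (v *m A) Uj; rewrite -/u; lra.
(* If [u <= c] everywhere, then [c] alone controls the norm and grows by a factor of at most
   [1 + eta] per step, which forces [normc z <= 1 + eta < l0]. *)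
- apply: contrapT => nuc.
  have uc v : u v <= c v.
    by rewrite leNgt; apply/negP => cv; apply: nuc; exists v.
  suff : Normc.normc z <= 1 + eta by lra.
  apply: (eigenvalue_growth (C := fun v => K * c v) zA); first by lra.
  move=> v k; have H : c (iter k (mulmxr A) v) <= (1 + eta) ^+ k * c v.
    elim: k => [|k IH]; first by rewrite expr0 mul1r.
    rewrite iterS exprS -mulrA /=; apply: (le_trans (cA _ _ (uc _) (lexx _))).
    by rewrite ler_wpM2l // addr_ge0 // ltW.
  apply: (le_trans (Kq _ _ (ucq _ _ (uc _) (lexx _)))).
  by rewrite mulrCA ler_wpM2l // ltW.
Qed.

(* Two points whose difference lies in the cone [c <= u] separate exponentially
   fast, so the points whose orbits stay near [p] form a Lipschitz graph over a
   hyperplane transverse to a vector [w] of the cone. *)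
Lemma locally_unstable_null (R : realType) n (h : 'rV[R]_n.+1 -> 'rV[R]_n.+1)
    p (A : 'M[R]_n.+1) (z : R[i]) :
  strictly_differentiable h p A ->
  eigenvalue (map_mx (real_complex R) A) z -> 1 < Normc.normc z ->
  exists2 d : R, 0 < d &
    hausdorff_null [set x | forall k, `|iter k h x - p| < d].
Proof.
move=> hA zA z1.
have [u [c [lam [mu [K [[mu1 mulam K0] [[uS cS ucK Kuc ucA] [w cuw]]]]]]]] :=
  unstable_cone zA z1.
(* A loss of [kap] in each rate leaves [lam - kap] above both [mu + kap] and 1. *)
pose kap := (lam - mu) / 4.
have kap0 : 0 < kap by rewrite divr_gt0 // subr_gt0.
have kapE : lam = mu + 4 * kap by rewrite /kap mulrC divfK // addrC subrK.
(* One [K] bounds [u] and [c] by the norm, the other bounds the norm by [u] on the cone. *)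
have e0 : 0 < kap / (K * K) by rewrite divr_gt0 // mulr_gt0.
have [d d0 Hd] := hA _ e0.
exists d => //; set W := [set x | _].
have step x y : `|x - p| < d -> `|y - p| < d -> c (x - y) <= u (x - y) ->
    (lam - kap) * u (x - y) <= u (h x - h y) /\
    c (h x - h y) <= (mu + kap) * u (x - y).
  move=> xd yd cu; pose v := x - y; pose r := h x - h y - v *m A.
  have rle : K * `|r| <= kap * u v.
    have H1 := Hd _ _ xd yd; have H2 := Kuc v _ (lexx _) cu.
    apply: (le_trans (ler_wpM2l (ltW K0) H1)).
    apply: (le_trans (ler_wpM2l (ltW K0) (ler_wpM2l (ltW e0) H2))).
    by rewrite le_eqVlt; apply/orP; left; apply/eqP; field; rewrite gt_eqF.
  have [rlu rlc] := ucK r.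
  have hE : h x - h y = v *m A + r by rewrite /r [RHS]addrC subrK.
  have [uA cA] := ucA v cu.
  split.
    have := uS.1 (h x - h y) (- r); rewrite seminormN // {1}hE addrK -/v; lra.
  by have := cS.1 (v *m A) r; rewrite -hE -/v; lra.
have cone x y : W x -> W y -> c (x - y) <= u (x - y) -> x = y.
  move=> Wx Wy cu.
  have H k : (lam - kap) ^+ k * u (x - y) <= u (iter k h x - iter k h y) /\
      c (iter k h x - iter k h y) <= u (iter k h x - iter k h y).
    elim: k => [|k [IH1 IH2]]; first by rewrite expr0 mul1r.
    have [s1 s2] := step _ _ (Wx k) (Wy k) IH2; rewrite !iterS; split.
      rewrite exprS -mulrA; apply: le_trans s1.
      by rewrite ler_wpM2l //; lra.
    apply: le_trans s1; apply: (le_trans s2).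
    by rewrite ler_wpM2r ?seminorm_ge0 //; lra.
  have ub k : u (iter k h x - iter k h y) <= K * (d + d).
    apply: (le_trans (ucK _).1); rewrite ler_wpM2l ?(ltW K0) //.
    have -> : iter k h x - iter k h y = (iter k h x - p) - (iter k h y - p).
      by rewrite opprB addrA subrK.
    by apply: (le_trans (ler_normB _ _)); rewrite lerD // ltW.
  (* A positive value would grow geometrically, whereas both orbits stay within [d] of [p]. *)
  have u0 : u (x - y) <= 0.
    rewrite leNgt; apply/negP => upos.
    have lk0 : 0 < lam - kap by lra.
    have := geometric_bound lk0 upos (fun k => le_trans (H k).1 (ub k)); lra.
  have := Kuc _ _ u0 (le_trans cu u0); rewrite mulr0 normr_le0 subr_eq0.
  by move/eqP.
have unc x y : W x -> W y -> u (x - y) <= c (x - y).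
  move=> Wx Wy; rewrite leNgt; apply/negP => /[dup] cu /ltW /(cone _ _ Wx Wy) xy.
  move: cu; rewrite xy subrr -(scale0r 0) !seminormZ // normr0 !mul0r ltxx.
  by [].
have [i wi] : exists i, w 0 i != 0.
  apply/rV0Pn; apply/eqP => w0; move: cuw.
  by rewrite w0 -(scale0r 0) !seminormZ // normr0 !mul0r ltxx.
(* Projection along [w] onto the hyperplane where coordinate [i] vanishes; [col' i] then drops that
   coordinate without changing the norm. *)
pose proj (x : 'rV[R]_n.+1) := x - (x 0 i / w 0 i) *: w.
have projB x y : proj (x - y) = proj x - proj y.
  rewrite /proj !mxE mulrBl scalerBl !opprB [X in _ + X = _]addrC addrACA.
  by rewrite [X in _ + X = _]addrC.
have projle x : `|proj x| <= `|col' i (proj x)|.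
  apply: row_norm_le => // j.
  have [k ->|->] := unliftP i j; last by rewrite !mxE divfK // subrr normr0.
  by apply: le_trans (row_norm_ge _ k); rewrite [X in _ <= `|X|]mxE.
have projge x : `|col' i (proj x)| <= (1 + `|w| / `|w 0 i|) * `|x|.
  apply: (@le_trans _ _ `|proj x|).
    by apply: row_norm_le => // j; rewrite mxE; exact: row_norm_ge.
  apply: (le_trans (ler_normB _ _)); rewrite mulrDl mul1r lerD2l.
  rewrite normrZ normrM normfV mulrAC [leRHS]mulrC mulrA.
  by rewrite ler_wpM2r ?invr_ge0 // ler_wpM2r // row_norm_ge.
pose g := u w - c w; have g0 : 0 < g by rewrite subr_gt0.
pose K' := 1 + 2 * K * `|w| / g.
have K'0 : 0 <= K'.
  by rewrite addr_ge0 // divr_ge0 ?(ltW g0) // !mulr_ge0 // ltW.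
pose b := 1 + (1 + `|w| / `|w 0 i|) * (`|p| + d).
apply: (@hausdorff_null_expanding _ _ _ (fun x => col' i (proj x)) b K') => //.
- by rewrite ltr_pwDl // mulr_ge0 // ?addr_ge0 ?divr_ge0 // ltW.
- move=> x Wx; apply: (le_lt_trans (projge x)).
  have xp : `|x| <= `|p| + d.
    rewrite -{1}(subrK p x) addrC (le_trans (ler_normD _ _)) // lerD2l ltW //.
    exact: (Wx 0%N).
  rewrite /b; apply: (@le_lt_trans _ _ ((1 + `|w| / `|w 0 i|) * (`|p| + d))).
    by rewrite ler_wpM2l // addr_ge0 // divr_ge0.
  by rewrite ltrDr.
- move=> x y Wx Wy.
  have -> : col' i (proj x) - col' i (proj y) = col' i (proj (x - y)).
    by rewrite projB; apply/rowP => j; rewrite !mxE.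
  set v := x - y; pose t := v 0 i / w 0 i.
  apply: (@le_trans _ _ (K' * `|proj v|)); last by rewrite ler_wpM2l.
  (* Inserting this into [u v <= c v] bounds [|t| * g] by [u (proj v) + c (proj v)], hence by
     [2 * K * |proj v|]. *)
  have vE : v = t *: w + proj v by rewrite /proj addrC subrK.
  have uv := unc _ _ Wx Wy; rewrite -/v in uv.
  have [ur cr] := ucK (proj v).
  have h1 : `|t| * u w <= u v + u (proj v).
    rewrite -(seminormZ t w uS); have := uS.1 v (- proj v).
    by rewrite seminormN // {1}vE addrK.
  have h2 : c v <= `|t| * c w + c (proj v).
    by rewrite -(seminormZ t w cS) {1}vE; exact: cS.1.
  have tg : `|t| <= 2 * K * `|proj v| / g by rewrite ler_pdivlMr // /g; lra.
  rewrite {1}vE; apply: (le_trans (ler_normD _ _)); rewrite normrZ.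
  rewrite /K' mulrDl mul1r addrC lerD2l.
  apply: (le_trans (ler_wpM2r (normr_ge0 w) tg)).
  by rewrite le_eqVlt; apply/orP; left; apply/eqP; field; rewrite gt_eqF.
Qed.

Theorem converges_to_unstable_null (R : realType) N
    (h : 'rV[R]_N -> 'rV[R]_N) (J : 'rV[R]_N -> 'M[R]_N) :
  (forall p, strictly_differentiable h p (J p)) ->
  (forall p, J p \in unitmx) ->
  lebesgue_null (converges_to_unstable h).
Proof.
move=> hJ uJ.
have unst p : linearly_unstable h p -> exists2 z : R[i],
    eigenvalue (map_mx (real_complex R) (J p)) z & 1 < Normc.normc z.
  move=> [_]; rewrite /spectral_radius (jacobian_strictly_differentiable (hJ p)).
  set S := [set _ | _ in _] => S1.
  (* An empty [S] is excluded because its [sup] is 0 by convention. *)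
  have [|_ [z zJ <-] z1] := @sup_gt _ S 1 _ S1; last by exists z.
  apply/set0P/negP => /eqP S0; move: S1.
  by rewrite S0 sup0 ltr10.
(* In dimension 0 there is no eigenvector, so the set is empty and the empty cover serves. *)
case: N h J hJ uJ unst => [|n] h J hJ uJ unst.
  have -> : converges_to_unstable h = set0.
    rewrite -subset0 => x [p [/unst[z /eigenvalueP[w _]]]].
    by rewrite thinmx0 eqxx.
  rewrite /lebesgue_null /lebesgue_outer_measure.
  apply/eqP; rewrite eq_le; apply/andP; split.
    apply: ereal_inf_lbound; exists pred0, (fun=> 0), (fun=> 0); split => //.
    by rewrite eseries_pred0.
  apply: le_ereal_inf_tmp => _ [P [a [b [ab _ ->]]]].
  by apply: nneseries_ge0 => k _ _; rewrite lee_fin big_ord0.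
apply: hausdorff_null_lebesgue_null => //.
(* A convergent orbit eventually stays in a small rational ball around its limit, so some iterate of
   its starting point lies in a null [W k]. *)
pose W k := [set x | forall t, rat_ball k (iter t h x)].
pose D := [set k : 'rV[rat]_n.+1 * nat | hausdorff_null (W k)].
apply: (@hausdorff_null_sub _ _ _
    (\bigcup_t \bigcup_(k in D) iter t h @^-1` W k)).
  move=> x [p [/unst[z zJ z1] xp]].
  have [d d0 nd] := locally_unstable_null (hJ p) zJ z1.
  have [k kp kd] := rat_ball_nbhs p d0.
  have [e e0 ke] : exists2 e : R, 0 < e & forall y, `|p - y| < e -> rat_ball k y.
    exists (k.2.+1%:R^-1 - `|p - map_mx ratr k.1|); first by rewrite subr_gt0.
    move=> y; rewrite ltrBrDr => H; apply: le_lt_trans H.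
    have -> : y - map_mx ratr k.1 = (p - map_mx ratr k.1) - (p - y).
      by rewrite opprB [RHS]addrC addrA subrK.
    by rewrite [leRHS]addrC ler_normB.
  have /cvgrPdist_lt/(_ _ e0)[T _ HT] := xp.
  exists T => //; exists k.
    by apply: hausdorff_null_sub nd => y Wy t; exact: kd.
  by move=> t; rewrite -iterD; apply: ke; apply: HT; rewrite /= leq_addl.
apply: hausdorff_null_bigcup => // t _; apply: hausdorff_null_bigcup => // k Dk.
elim: t => [//|t IH].
rewrite (_ : iter t.+1 h @^-1` W k = h @^-1` (iter t h @^-1` W k)).
  exact: (hausdorff_null_preimage _ hJ).
by apply/seteqP; split=> x; rewrite /preimage /= -iterSr.
Qed.

(** * Gradient descent/ascent *)

Lemma strictly_differentiable_mulmx (R : realType) M N (A : 'M[R]_(M, N)) p :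
  strictly_differentiable (mulmxr A) p A.
Proof.
move=> e e0; exists 1 => // x y _ _.
by rewrite /= mulmxBl subrr normr0 mulr_ge0 // ltW.
Qed.

Lemma strictly_differentiableD (R : realType) M N (g h : 'rV[R]_M -> 'rV[R]_N)
    p A B :
  strictly_differentiable g p A -> strictly_differentiable h p B ->
  strictly_differentiable (g \+ h) p (A + B).
Proof.
move=> gA hB e e0.
have e20 : 0 < e / 2 by rewrite divr_gt0.
have [d1 d10 H1] := gA _ e20; have [d2 d20 H2] := hB _ e20.
exists (Num.min d1 d2); first by rewrite lt_min d10.
move=> x y; rewrite !lt_min => /andP[x1 x2] /andP[y1 y2].
have -> : (g \+ h) x - (g \+ h) y - (x - y) *m (A + B) =
    (g x - g y - (x - y) *m A) + (h x - h y - (x - y) *m B).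
  by rewrite /= mulmxDr !opprD [X in X + _ = _]addrACA [LHS]addrACA.
rewrite (splitr e) mulrDl; apply: (le_trans (ler_normD _ _)).
by rewrite lerD ?H1 ?H2.
Qed.

Lemma strictly_differentiable_comp_mulmx (R : realType) M N K L
    (g : 'rV[R]_N -> 'rV[R]_K) (P : 'M[R]_(M, N)) (Q : 'M[R]_(K, L)) p A :
  strictly_differentiable g (p *m P) A ->
  strictly_differentiable (fun x => g (x *m P) *m Q) p (P *m A *m Q).
Proof.
move=> gA e e0.
pose p1 := M%:R * `|P| + 1; pose q1 := K%:R * `|Q| + 1.
have p10 : 0 < p1 by rewrite ltr_pwDr // mulr_ge0.
have q10 : 0 < q1 by rewrite ltr_pwDr // mulr_ge0.
have Ple (v : 'rV[R]_M) : `|v *m P| <= p1 * `|v|.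
  by apply: (le_trans (mulmx_norm_le _ _)); rewrite ler_wpM2r // lerDl.
have Qle (v : 'rV[R]_K) : `|v *m Q| <= q1 * `|v|.
  by apply: (le_trans (mulmx_norm_le _ _)); rewrite ler_wpM2r // lerDl.
have e'0 : 0 < e / (p1 * q1) by rewrite divr_gt0 // mulr_gt0.
have [d d0 H] := gA _ e'0.
exists (d / p1); first by rewrite divr_gt0.
move=> x y; rewrite !ltr_pdivlMr // => xd yd.
have near (v : 'rV[R]_M) : `|v - p| * p1 < d -> `|v *m P - p *m P| < d.
  by move=> vd; rewrite -mulmxBl (le_lt_trans (Ple _)) // mulrC.
have -> : g (x *m P) *m Q - g (y *m P) *m Q - (x - y) *m (P *m A *m Q) =
    (g (x *m P) - g (y *m P) - (x *m P - y *m P) *m A) *m Q.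
  by rewrite !mulmxBl !mulmxA.
apply: (le_trans (Qle _)).
apply: (le_trans (ler_wpM2l (ltW q10) (H _ _ (near _ xd) (near _ yd)))).
rewrite -mulmxBl.
apply: (le_trans (ler_wpM2l (ltW q10) (ler_wpM2l (ltW e'0) (Ple _)))).
by rewrite le_eqVlt; apply/orP; left; apply/eqP; field; rewrite !gt_eqF.
Qed.

(** The mean value theorem on the segment from [y] to [x], applied to each coordinate [j], gives
    coordinate [j] of [g x - g y] as that of [v *m 'J g (F c)]. The ball around [p] is convex, so
    ['J g (F c)] is close to ['J g p]. *)
Lemma continuous_jacobian_strictly_differentiable (R : realType) M N
    (g : 'rV[R]_M -> 'rV[R]_N) p :
  (forall x, differentiable g x) -> {for p, continuous (jacobian g)} ->
  strictly_differentiable g p ('J g p).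
Proof.
move=> dg cJ e e0.
have e'0 : 0 < e / (M%:R + 1) by rewrite divr_gt0 // ltr_pwDr.
have /cvgrPdist_lt/(_ _ e'0)/nbhs_ballP[d /= d0 Hd] := cJ.
exists d => // x y xd yd; apply: row_norm_le => [|j].
  by rewrite mulr_ge0 // ltW.
set v : 'rV[R]_M := x - y.
pose F (t : R) : 'rV[R]_M := y + t *: v.
have dF (t : R) : is_derive t 1 (fun t : R => g (F t) 0 j)
    ((v *m 'J g (F t)) 0 j).
  have dgv : derivable g (F t) v by exact: diff_derivable.
  have quot : (fun s => s^-1 *:
      (((fun t : R => g (F t) 0 j) \o shift t) (s *: (1 : R)) - g (F t) 0 j)) =
      (fun s => s^-1 *:
      (((fun x => g x 0 j) \o shift (F t)) (s *: v) - g (F t) 0 j)).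
    apply/funext => s /=; congr (_ *: (g _ 0 j - _)).
    by rewrite /F [s *: 1]mulr1 scalerDl addrCA.
  have dgj := (derivable_mxP _ _ _).1 dgv 0 j.
  apply: DeriveDef; first by rewrite /derivable quot.
  by rewrite -deriveEjacobian // (derive_mx dgv) mxE /derive quot.
have [|c] := @MVT_segment R (fun t : R => g (F t) 0 j) _ 0 1 ler01
  (fun t _ => dF t).
  by apply: derivable_within_continuous => t _; have [] := dF t.
rewrite in_itv /= => /andP[c0 c1].
rewrite /F scale1r scale0r addr0 /v addrCA subrr addr0 subr0 mulr1 -/v => gE.
have -> : (g x - g y - v *m 'J g p) 0 j = (v *m ('J g (F c) - 'J g p)) 0 j.
  have subE (a b : 'rV[R]_N) : (a - b) 0 j = a 0 j - b 0 j by rewrite !mxE.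
  by rewrite mulmxBr !subE gE.
apply: (le_trans (row_norm_ge _ _)); apply: (le_trans (mulmx_norm_le _ _)).
rewrite ler_wpM2r //.
have Fd : ball p d (F c).
  rewrite -ball_normE /= distrC.
  have -> : F c - p = c *: (x - p) + (1 - c) *: (y - p).
    rewrite /F /v !scalerBr !scalerBl !scale1r.
    by apply/rowP => i; rewrite !mxE; ring.
  apply: (le_lt_trans (ler_normD _ _)); rewrite !normrZ !ger0_norm ?subr_ge0 //.
  have := ler_wpM2l c0 (ltW xd); have := xd; have := yd.
  (* For [c = 0] the strict inequality comes from [y] alone; otherwise from the term in [x]. *)
  have [->|cn0] := eqVneq c 0; first by rewrite !mul0r subr0 mul1r add0r.
  have cp : 0 < c by rewrite lt_def cn0.
  have : c * `|x - p| < c * d by rewrite ltr_pM2l.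
  have := ler_wpM2l (_ : 0 <= 1 - c) (ltW yd); rewrite subr_ge0 => /(_ c1).
  lra.
have M10 : 0 < M%:R + 1 :> R by rewrite ltr_pwDr.
have H : `|'J g (F c) - 'J g p| <= e / (M%:R + 1).
  by rewrite distrC; exact: ltW (Hd _ Fd).
apply: (@le_trans _ _ (M%:R * (e / (M%:R + 1)))); first by rewrite ler_wpM2l.
by rewrite mulrCA ger_pMr // ler_pdivrMr // mul1r lerDl.
Qed.

Lemma unitmx_injective (F : fieldType) N (A : 'M[F]_N) :
  (forall v : 'rV_N, v *m A = 0 -> v = 0) -> A \in unitmx.
Proof.
move=> A0; rewrite -row_free_unit -kermx_eq0; apply/eqP/row_matrixP => i.
by rewrite row0; apply: A0; rewrite -row_mul mulmx_ker row0.
Qed.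

(** * The Euclidean norm and the Lipschitz bound on the Jacobian *)

Section EuclideanNorm.
Variable R : realType.

Lemma eucl_norm_continuous N : continuous (@eucl_norm R N).
Proof.
pose s (v : 'rV[R]_N) := \sum_(i < N) v 0 i ^+ 2.
have sc : continuous s.
  apply: continuous_big => [|i _]; first exact: add_continuous.
  move=> v; apply: (@continuous_comp _ _ _ (fun x : 'rV[R]_N => x 0 i)
    (fun y : R => y ^+ 2)); first exact: coord_continuous.
  exact: exprn_continuous.
move=> v; apply: (@continuous_comp _ _ _ s (@Num.sqrt R)); first exact: sc.
exact: sqrt_continuous.
Qed.

Lemma eucl_normZ N a (v : 'rV[R]_N) : eucl_norm (a *: v) = `|a| * eucl_norm v.
Proof.
rewrite /eucl_norm -sqrtr_sqr -sqrtrM ?sqr_ge0 // mulr_sumr; congr Num.sqrt.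
by apply: eq_bigr => i _; rewrite mxE exprMn.
Qed.

Lemma eucl_norm_le0 N (v : 'rV[R]_N) : eucl_norm v <= 0 -> v = 0.
Proof.
rewrite /eucl_norm => v0; have : eucl_norm v == 0.
  by rewrite eq_le v0 sqrtr_ge0.
rewrite sqrtr_eq0 => s0.
have /eqP : \sum_(i < N) v 0 i ^+ 2 = 0.
  by apply/eqP; rewrite eq_le s0 sumr_ge0 // => i _; exact: sqr_ge0.
rewrite psumr_eq0 => [/allP H|i _]; last exact: sqr_ge0.
apply/rowP => i; rewrite mxE; apply/eqP; rewrite -sqrf_eq0.
by have := H i; rewrite mem_index_enum => /(_ isT).
Qed.

(** [v *m 'J g p] is the limit of difference quotients along [v], each of Euclidean norm at most
    [L * eucl_norm v]. *)
Lemma jacobian_eucl_norm_le M N (g : 'rV[R]_M -> 'rV[R]_N) L p v :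
  (forall x y, eucl_norm (g x - g y) <= L * eucl_norm (x - y)) ->
  differentiable g p -> eucl_norm (v *m 'J g p) <= L * eucl_norm v.
Proof.
move=> gL dg; rewrite -deriveEjacobian //.
have dv : derivable g p v by exact: diff_derivable.
pose q (t : R) := t^-1 *: ((g \o shift p) (t *: v) - g p).
have H : (@eucl_norm R N \o q) t @[t --> 0^'] --> eucl_norm ('D_v g p).
  by apply: continuous_cvg dv; exact: eucl_norm_continuous.
apply: (cvgr_to_le H); near=> t.
have t0 : t != 0 by near: t; exact: nbhs_dnbhs_neq.
rewrite /= eucl_normZ; apply: (le_trans (ler_wpM2l (normr_ge0 _) (gL _ _))).
rewrite addrK eucl_normZ normfV mulrCA mulKf ?normr_eq0 //.
Unshelve. all: by end_near. Qed.

End EuclideanNorm.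

(* The sign matrix turning the gradient into (grad_x, - grad_y). *)
Definition descent_ascent_mx (R : realType) n m : 'M[R]_(n + m) :=
  block_mx 1%:M 0 0 (- 1%:M).

Lemma mulmx_descent_ascent (R : realType) n m (v : 'rV[R]_(n + m)) :
  v *m descent_ascent_mx R n m = row_mx (lsubmx v) (- rsubmx v).
Proof.
rewrite -{1}(hsubmxK v) mul_row_block !mulmx0 !mulmx1 mulmxN mulmx1.
by rewrite addr0 add0r.
Qed.

Lemma eucl_norm_descent_ascent (R : realType) n m (v : 'rV[R]_(n + m)) :
  eucl_norm (v *m descent_ascent_mx R n m) = eucl_norm v.
Proof.
rewrite mulmx_descent_ascent -[in RHS](hsubmxK v) /eucl_norm !big_split_ord.
congr (Num.sqrt (_ + _)); apply: eq_bigr => i _; first by rewrite !row_mxEl.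
by rewrite !row_mxEr mxE sqrrN.
Qed.

(** The factor [1%:M] inside [grad f] gives the term the shape required by
    [strictly_differentiable_comp_mulmx]. *)
Lemma GDAE (R : realType) n m (f : 'rV[R]_(n + m) -> R) alpha :
  GDA f alpha = mulmxr 1%:M \+
    (fun x => grad f (x *m 1%:M) *m (- alpha *: descent_ascent_mx R n m)).
Proof.
apply/funext => p; rewrite /= !mulmx1 -scalemxAr mulmx_descent_ascent.
rewrite -[X in _ = X + _](hsubmxK p) scale_row_mx add_row_mx.
by rewrite scalerN !scaleNr opprK.
Qed.

(** On a state [(p, q)] the two [col_mx] factors select [p] and [q], and the block matrix yields
    [(p, p)]. *)
Lemma OGDAE (R : realType) n m (f : 'rV[R]_(n + m) -> R) alpha :
  let D := descent_ascent_mx R n m in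
  OGDA f alpha = mulmxr (block_mx 1%:M 1%:M 0 0) \+
    ((fun x => grad f (x *m col_mx 1%:M 0) *m row_mx (- (2 * alpha) *: D) 0) \+
     (fun x => grad f (x *m col_mx 0 1%:M) *m row_mx (alpha *: D) 0)).
Proof.
move=> D; apply/funext => s; rewrite /=.
have [p [q ->]] : exists p q, s = row_mx p q.
  by exists (lsubmx s), (rsubmx s); rewrite hsubmxK.
rewrite /OGDA row_mxKl row_mxKr mul_row_block !mul_row_col !mul_mx_row.
rewrite !mulmx1 !mulmx0 !addr0 !add0r !add_row_mx !addr0.
congr row_mx; rewrite -!scalemxAr.
rewrite !mulmx_descent_ascent !scale_row_mx !add_row_mx.
rewrite -[X in _ = X + _](hsubmxK p) add_row_mx.
by congr row_mx; rewrite addrA ?scalerN !scaleNr ?opprK.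
Qed.

(* The matrix is the Jacobian of OGDA at a state (p, q), with [H1], [H2] the
   Hessians at p and q; it is injective as soon as [H2] and [B2] are. *)
Lemma mul_row_companion (F : pzRingType) N (x y : 'rV[F]_N)
    (H1 H2 B1 B2 : 'M[F]_N) :
  row_mx x y *m (block_mx 1%:M 1%:M 0 0 + (col_mx 1%:M 0 *m H1 *m row_mx B1 0 +
    col_mx 0 1%:M *m H2 *m row_mx B2 0)) =
  row_mx (x + (x *m H1 *m B1 + y *m H2 *m B2)) x.
Proof.
rewrite !mulmxDr !mulmxA mul_row_block !mul_row_col !mulmx1 !mulmx0 !addr0 add0r.
by rewrite !mul_mx_row !mulmx0 !add_row_mx !addr0.
Qed.

Theorem theorem1p11 (R : realType) (n m : nat) (f : 'rV[R]_(n + m) -> R)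
    (L alpha : R)
    (f_C2 : twice_continuously_differentiable f)
    (grad_lipschitz : forall p q : 'rV[R]_(n + m),
       eucl_norm (grad f p - grad f q) <= L * eucl_norm (p - q))
    (alpha_gt0 : 0 < alpha) (alpha_lt : alpha < 1 / L) :
  lebesgue_null (converges_to_unstable (GDA f alpha)) /\
  ((forall p : 'rV[R]_(n + m), hessian f p \in unitmx) ->
   lebesgue_null (converges_to_unstable (OGDA f alpha))).
Proof.
have [_ dg cH] := f_C2.
have L0 : 0 < L by have := lt_trans alpha_gt0 alpha_lt; rewrite div1r invr_gt0.
have aL : alpha * L < 1 by rewrite -ltr_pdivlMr.
have gH p : strictly_differentiable (grad f) p (hessian f p).
  by apply: continuous_jacobian_strictly_differentiable; [|exact: cH].
set D := descent_ascent_mx R n m.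
have normD (v : 'rV[R]_(n + m)) : eucl_norm (v *m D) = eucl_norm v.
  exact: eucl_norm_descent_ascent.
have vD0 (v : 'rV[R]_(n + m)) : v *m D = 0 -> v = 0.
  by move=> vD; apply: eucl_norm_le0; rewrite -normD vD -(scale0r 0)
    eucl_normZ normr0 mul0r.
split=> [|uH].
- apply: (@converges_to_unstable_null _ _ _
    (fun p => 1%:M + 1%:M *m hessian f p *m (- alpha *: D))) => p.
    rewrite GDAE; apply: strictly_differentiableD.
      exact: strictly_differentiable_mulmx.
    by apply: strictly_differentiable_comp_mulmx; rewrite mulmx1.
  (* A kernel vector satisfies [v = alpha *: (v *m hessian f p *m D)]. As [D] is an isometry, its
     norm is at most [alpha * L] times itself, hence zero. *)
  apply: unitmx_injective => v; rewrite mul1mx mulmxDr mulmx1 mulmxA.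
  rewrite -scalemxAr scaleNr => /eqP; rewrite subr_eq0 => /eqP vE.
  apply: eucl_norm_le0; rewrite leNgt; apply/negP => v0.
  have := jacobian_eucl_norm_le v grad_lipschitz (dg p).
  rewrite -/(hessian f p) -normD => H.
  have : eucl_norm v <= alpha * (L * eucl_norm v).
    rewrite {1}vE eucl_normZ gtr0_norm //.
    by rewrite ler_pM2l.
  by rewrite mulrA leNgt gtr_pMl // aL.
- apply: (@converges_to_unstable_null _ _ _ (fun s =>
    block_mx 1%:M 1%:M 0 0 +
    (col_mx 1%:M 0 *m hessian f (lsubmx s) *m row_mx (- (2 * alpha) *: D) 0 +
     col_mx 0 1%:M *m hessian f (rsubmx s) *m row_mx (alpha *: D) 0))) => s.
    rewrite OGDAE; apply: strictly_differentiableD.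
      exact: strictly_differentiable_mulmx.
    apply: strictly_differentiableD; apply: strictly_differentiable_comp_mulmx.
      by rewrite -{1}(hsubmxK s) mul_row_col mulmx1 mulmx0 addr0.
    by rewrite -{1}(hsubmxK s) mul_row_col mulmx1 mulmx0 add0r.
  (* For a kernel vector [(x, y)] the second block gives [x = 0]; the first then gives
     [y *m hessian f q *m D = 0] with [q = rsubmx s], since [alpha] is nonzero. *)
  apply: unitmx_injective => v; rewrite -(hsubmxK v) mul_row_companion.
  set x := lsubmx v; set y := rsubmx v => vJ0.
  have := congr1 rsubmx vJ0; rewrite row_mxKr linear0 => x0.
  have := congr1 lsubmx vJ0; rewrite row_mxKl linear0 x0 !mul0mx !add0r.
  rewrite -scalemxAr => /eqP; rewrite scaler_eq0 gt_eqF //= => /eqP/vD0 yH.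
  by rewrite -(mulmxK (uH (rsubmx s)) y) yH mul0mx row_mx0.
Qed.
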